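(* In the setting described in the context (data $\Omega,\mathcal{U},f,\ell,C$ and the associated set-valued mapping $F$), it holds that $$\operatorname{wargmin}(\mathcal{UP})=\operatorname{wargmin}^l(\mathcal{SP}),$$ where $(\mathcal{SP})$ is the set optimization problem of minimizing $F(x)$ over $x\in\Omega$.
   Context: Conventions: inequalities between vectors are componentwise; $e$ is the all-ones vector; $\mathbb{R}^m_+$ is the nonnegative orthant; $\operatorname{Int}$, $\operatorname{cl}$, $(\cdot)^c$ are interior, closure, complement in $\mathbb{R}^m$. A cone $C$ (i.e. $\lambda\ge0$, $c\in C$ imply $\lambda c\in C$) is pointed if $C\cap(-C)=\{0\}$ and solid if $\operatorname{Int}C\neq\emptyset$. For nonempty $A,B\subseteq\mathbb{R}^m$, $A\prec^l B$ means $B\subseteq A+\operatorname{Int}\mathbb{R}^m_+$. Setting: $\Omega\subseteq\mathbb{R}^n$ and $\mathcal{U}\subseteq\mathbb{R}^k$ are nonempty and closed, $\mathcal{U}$ is compact, and $f:\Omega\times\mathcal{U}\to\mathbb{R}^m$ is continuous. $\ell\in\mathbb{R}^m$ is a vector and $C\subseteq(\operatorname{Int}\mathbb{R}^m_+)\cup\{0\}$ is a closed, convex, pointed, solid cone such that $f(\Omega\times\mathcal{U})\subseteq\{\ell\}+\operatorname{Int}C$. For $x\in\Omega$ put $F_{\mathcal{U}}(x):=\{f(x,u)\mid u\in\mathcal{U}\}$. The set $\operatorname{wargmin}(\mathcal{UP})$ of robust weakly efficient solutions consists of all $\bar x\in\Omega$ for which there is no $x\in\Omega$ with $F_{\mathcal{U}}(x)\subseteq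 F_{\mathcal{U}}(\bar x)-\operatorname{Int}\mathbb{R}^m_+$. Let $\mathrm{ub}(x):=\big(\sup_{u\in\mathcal{U}}f_1(x,u),\dots,\sup_{u\in\mathcal{U}}f_m(x,u)\big)^\top+e$, $[y^1,y^2]_C:=(\{y^1\}+C)\cap(\{y^2\}-\mathbb{R}^m_+)$, and $F(x):=\operatorname{cl}\big((F_{\mathcal{U}}(x)-\mathbb{R}^m_+)^c\big)\cap[\ell,\mathrm{ub}(x)]_C$ for $x\in\Omega$. $\operatorname{wargmin}^l(\mathcal{SP})$ is the set of $l$-weakly efficient solutions of $(\mathcal{SP})$: all $\bar x\in\Omega$ for which there is no $x\in\Omega$ with $F(x)\prec^l F(\bar x)$. *)

(* Defs.v *)
From HB Require Import structures.
From mathcomp Require Import all_boot all_order all_algebra.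
From mathcomp Require Import all_classical all_reals all_analysis.
Set Implicit Arguments.
Unset Strict Implicit.
Unset Printing Implicit Defensive.
Import Order.TTheory GRing.Theory Num.Theory.
Import numFieldNormedType.Exports.
Local Open Scope classical_set_scope.
Local Open Scope ring_scope.

Definition set_add {V : zmodType} (A B : set V) : set V :=
  [set a + b | a in A & b in B].

Definition set_sub {V : zmodType} (A B : set V) : set V :=
  [set a - b | a in A & b in B].

Definition orthant (R : realType) (m : nat) : set 'rV[R]_m :=
  [set y | forall j, 0 <= y 0 j].
Arguments orthant : clear implicits.

Definition is_cone {R : realType} {m : nat} (C : set 'rV[R]_m) : Prop :=
  forall (t : R) (c : 'rV[R]_m), 0 <= t -> C c -> C (t *: c).

Definition pointed_cone {R : realType} {m : nat} (C : set 'rV[R]_m) : Prop :=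
  C `&` [set - c | c in C] = [set 0].

Definition solid {R : realType} {m : nat} (C : set 'rV[R]_m) : Prop :=
  interior C !=set0.

(* [l_strict A B] is the strict lower set less relation A <^l B. *)
Definition l_strict {R : realType} {m : nat} (A B : set 'rV[R]_m) : Prop :=
  B `<=` set_add A (interior (orthant R m)).

Definition l_wargmin {R : realType} {m : nat} {X : Type} (Omega : set X)
    (F : X -> set 'rV[R]_m) : set X :=
  [set xbar | Omega xbar /\ ~ exists2 x, Omega x & l_strict (F x) (F xbar)].

(* A map on Omega `*` U is given as a total function of pairs; its values
   outside Omega `*` U are irrelevant. *)

Definition FU {R : realType} {n k m : nat} (U : set 'rV[R]_k)
    (f : 'rV[R]_n * 'rV[R]_k -> 'rV[R]_m) (x : 'rV[R]_n) : set 'rV[R]_m :=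
  [set f (x, u) | u in U].

Definition robust_wargmin {R : realType} {n k m : nat} (Omega : set 'rV[R]_n)
    (U : set 'rV[R]_k) (f : 'rV[R]_n * 'rV[R]_k -> 'rV[R]_m) : set 'rV[R]_n :=
  [set xbar | Omega xbar /\
    ~ exists2 x, Omega x &
        FU U f x `<=` set_sub (FU U f xbar) (interior (orthant R m))].

(* The real-valued [sup] is the supremum here because [U] is nonempty and
   compact and [f (x, _)] is continuous on it, for [x] in Omega. *)
Definition ub {R : realType} {n k m : nat} (U : set 'rV[R]_k)
    (f : 'rV[R]_n * 'rV[R]_k -> 'rV[R]_m) (x : 'rV[R]_n) : 'rV[R]_m :=
  (\row_j sup [set f (x, u) 0 j | u in U]) + const_mx 1.

(* The upper bound is taken for the orthant, not for [C]. *)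
Definition mixed_interval {R : realType} {m : nat} (C : set 'rV[R]_m)
    (y1 y2 : 'rV[R]_m) : set 'rV[R]_m :=
  set_add [set y1] C `&` set_sub [set y2] (orthant R m).

Definition SP_map {R : realType} {n k m : nat} (U : set 'rV[R]_k)
    (f : 'rV[R]_n * 'rV[R]_k -> 'rV[R]_m) (l : 'rV[R]_m) (C : set 'rV[R]_m)
    (x : 'rV[R]_n) : set 'rV[R]_m :=
  closure (~` set_sub (FU U f x) (orthant R m))
  `&` mixed_interval C l (ub U f x).

(* Main.v *)
Require Import Defs.
From mathcomp Require Import all_boot all_order all_algebra.
From mathcomp Require Import all_classical all_reals all_analysis.
Import Order.TTheory GRing.Theory Num.Theory.
Import numFieldNormedType.Exports.
Local Open Scope classical_set_scope.
Local Open Scope ring_scope.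
Set Implicit Arguments.
Unset Strict Implicit.
Unset Printing Implicit Defensive.

(** The two notions of solution agree because, for any two feasible points
[x] and [xbar], the relations defining them are equivalent:
[F(xbar)] lies in [F(x) + Int R^m_+] exactly when [F_U(x)] lies in
[F_U(xbar) - Int R^m_+] ([l_strict_SP_map]).

Write [S(x) = F_U(x) - R^m_+].  Its interior is [F_U(x) - Int R^m_+], so the
closure of its complement, which defines [F(x)], is the complement of
[F_U(x) - Int R^m_+].  Thus [F(x)] consists of the points of [l + C], below
[ub(x)], that are not strictly dominated by an element of [F_U(x)].

Since [U] is compact, [S(x)] is closed, and [l] is in its interior because
[F_U(x)] lies in [l + Int C].  Take [c] in [C] such that [l + c] is not
interior to [S(x)].  On the segment from [l] to [l + c], the last point of
[S(x)] is a boundary point of [S(x)]; it lies in [l + C] since [C] is a cone,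
and below [ub(x)] since every point of [S(x)] does.  So it belongs to [F(x)],
and it is below [l + c] ([SP_map_on_ray]).  Both implications use this point.

- If [F_U(x)] lies in [F_U(xbar) - Int R^m_+] and [y = l + c] is in
  [F(xbar)], then [y] is outside [S(x)], so the exit point from [S(x)]
  differs from [y] and is strictly smaller, as [c] is in [Int R^m_+].
- If [F(xbar)] lies in [F(x) + Int R^m_+] and some [a] in [F_U(x)] were
  outside [F_U(xbar) - Int R^m_+], the exit point from [S(xbar)] on the way
  to [a] would be in [F(xbar)], hence strictly above some [z] in [F(x)]; then
  [z] is strictly below [a], which membership in [F(x)] forbids. *)

Lemma interior_orthantP (R : realType) (m : nat) (y : 'rV[R]_m) :
  interior (orthant R m) y <-> forall j, 0 < y 0 j.
Proof.
split=> [/nbhs_ballP[e /= e0 ye] j|y0].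
  have /ye /(_ j) : ball y e (y - const_mx (e / 2)).
    split=> // i' j'; rewrite !mxE /ball /= opprB addrC subrK.
    by rewrite gtr0_norm ?divr_gt0// ltr_pdivrMr// ltr_pMr// ltr1n.
  by rewrite !mxE subr_ge0; apply: lt_le_trans; rewrite divr_gt0.
suff : nbhs y [set z : 'rV[R]_m | forall j, 0 <= z 0 j] by [].
apply: (@filter_forall _ _
  (fun j => [set z : 'rV[R]_m | 0 <= z 0 j]) (nbhs y) _) => j.
by apply: (cvgr_ge (y 0 j)) => //; exact: coord_continuous.
Qed.

Lemma sub_orthantP (R : realType) (m : nat) (K : set 'rV[R]_m) (y : 'rV[R]_m) :
  set_sub K (orthant R m) y <-> exists2 a, K a & forall j, y 0 j <= a 0 j.
Proof.
split=> [[a Ka [r r0 <-]]|[a Ka ya]].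
  by exists a => // j; rewrite !mxE gerBl r0.
by exists a => //; exists (a - y); [move=> j; rewrite !mxE subr_ge0|
  rewrite opprB addrC subrK].
Qed.

Lemma sub_interior_orthantP (R : realType) (m : nat) (K : set 'rV[R]_m)
    (y : 'rV[R]_m) :
  set_sub K (interior (orthant R m)) y <->
  exists2 a, K a & forall j, y 0 j < a 0 j.
Proof.
split=> [[a Ka [r /interior_orthantP r0 <-]]|[a Ka ya]].
  by exists a => // j; rewrite !mxE gtrBl r0.
exists a => //; exists (a - y); last by rewrite opprB addrC subrK.
by apply/interior_orthantP => j; rewrite !mxE subr_gt0.
Qed.

(** If a point can be moved up along the all-ones vector without leaving
[K - R^m_+], then it is strictly below some element of [K]. *)
Lemma interior_sub_orthant (R : realType) (m : nat) (K : set 'rV[R]_m) :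
  interior (set_sub K (orthant R m)) = set_sub K (interior (orthant R m)).
Proof.
apply/seteqP; split=> y.
  move=> /nbhs_ballP[e /= e0 ye]; apply/sub_interior_orthantP.
  have /ye /sub_orthantP[a Ka ya] : ball y e (y + const_mx (e / 2)).
    split=> // i' j'; rewrite !mxE /ball /= opprD addrA subrr sub0r normrN.
    by rewrite gtr0_norm ?divr_gt0// ltr_pdivrMr// ltr_pMr// ltr1n.
  exists a => // j; apply: lt_le_trans (ya j).
  by rewrite !mxE ltrDl divr_gt0.
move=> /sub_interior_orthantP[a Ka ya].
suff : nbhs y [set z : 'rV[R]_m | forall j, z 0 j <= a 0 j].
  by apply: filterS => z za; apply/sub_orthantP; exists a.
apply: (@filter_forall _ _
  (fun j => [set z : 'rV[R]_m | z 0 j <= a 0 j]) (nbhs y) _) => j.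
by apply: (cvgr_le (y 0 j)) => //; exact: coord_continuous.
Qed.

(** A point [y] outside the set fails [y <= a] for each [a] in [K], through a
coordinate that may depend on [a].  Each failure persists for nearby [y] and
[a], and compactness makes the neighbourhood of [y] uniform in [a]. *)
Lemma closed_sub_orthant (R : realType) (m : nat) (K : set 'rV[R]_m) :
  compact K -> closed (set_sub K (orthant R m)).
Proof.
move=> /compact_near_coveringP cK; rewrite -openC openE => y yK.
pose P (z a : 'rV[R]_m) := exists j, a 0 j < z 0 j.
have : \forall z \near y, K `<=` P z.
  apply: (cK _ (nbhs y) P) => a Ka.
  have [j aj] : exists j, a 0 j < y 0 j.
    apply: contra_notP yK => ya; apply/sub_orthantP; exists a => // j.
    by rewrite leNgt; apply/negP => aj; apply: ya; exists j.
  have /midf_lt[am my] := aj.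
  near=> b z => /=; exists j.
  apply: (@lt_trans _ _ ((a 0 j + y 0 j) / 2)).
    by near: b; apply: (cvgr_lt (a 0 j)) => //; exact: coord_continuous.
  by near: z; apply: (cvgr_gt (y 0 j)) => //; exact: coord_continuous.
apply: filterS => z zK /sub_orthantP[a Ka za].
by have [j] := zK a Ka; rewrite ltNge za.
Unshelve. all: by end_near. Qed.

(** The point sought is the one with the largest parameter among those of the
segment that belong to [S].  If it were interior to [S], later points of the
segment would still be in [S]. *)
Lemma segment_leaves_closed (R : realType) (V : normedModType R) (S : set V)
    (p c : V) :
  closed S -> S p -> ~ interior S (p + c) ->
  exists2 t : R, 0 <= t <= 1 & S (p + t *: c) /\ ~ interior S (p + t *: c).
Proof.
move=> clS Sp pcS.
have cont : continuous (fun t : R => p + t *: c).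
  by move=> t; apply: cvgD; [exact: cvg_cst|exact: scalel_continuous].
pose T := [set t : R | t <= 1] `&` (fun t => p + t *: c) @^-1` S.
have T0 : T 0 by split; rewrite /= ?scale0r ?addr0.
have ubT : has_ubound T by exists 1 => t [].
have : T (sup T).
  have clT : closed T.
    by apply: closedI; [exact: closed_le|exact: preimage_closed].
  rewrite [T in T _](closure_id T).1//.
  by apply: closure_sup => //; exists 0.
set t := sup T => -[/= t1 St].
have t0 : 0 <= t by exact: ub_le_sup.
exists t; first by rewrite t0.
split=> // intSt; move: t1; rewrite le_eqVlt => /predU1P[t1|t1].
  by move: intSt; rewrite t1 scale1r.
have : \forall s \near t^'+, [/\ t < s, s < 1 & S (p + s *: c)].
  near=> s; split; near: s; [exact: nbhs_right_gt|exact: nbhs_right_lt|].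
  by apply: cvg_within; exact: cont.
move=> /filter_ex[s [+ s1 Ss]]; rewrite ltNge => /negP; apply.
by apply: ub_le_sup => //; split => //=; exact: ltW.
Unshelve. all: by end_near. Qed.

Lemma compact_FU (R : realType) (n k m : nat) (Omega : set 'rV[R]_n)
    (U : set 'rV[R]_k) (f : 'rV[R]_n * 'rV[R]_k -> 'rV[R]_m) (x : 'rV[R]_n) :
  compact U -> {within Omega `*` U, continuous f} -> Omega x ->
  compact (FU U f x).
Proof.
move=> cU cf Ox.
(* [f] is continuous on a product only, so [x] is kept as a singleton factor. *)
have -> : FU U f x = f @` ([set x] `*` U).
  apply/seteqP; split=> y /=; first by move=> [u Uu <-]; exists (x, u).
  by move=> [[_ u] [/= -> Uu] <-]; exists u.
apply: continuous_compact; last exact: (compact_setX (@compact_set1 _ x) cU).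
by apply: continuous_subspaceW cf => -[_ u] [/= -> Uu]; split.
Qed.

Lemma sub_orthant_le_ub (R : realType) (n k m : nat) (U : set 'rV[R]_k)
    (f : 'rV[R]_n * 'rV[R]_k -> 'rV[R]_m) (x : 'rV[R]_n) (y : 'rV[R]_m) :
  compact (FU U f x) -> set_sub (FU U f x) (orthant R m) y ->
  forall j, y 0 j <= ub U f x 0 j.
Proof.
move=> cK /sub_orthantP[a [u Uu <-] ya] j; apply: (le_trans (ya j)).
rewrite !mxE ler_wpDr//; apply: ub_le_sup; last by exists u.
have -> : [set f (x, u) 0 j | u in U] = (fun v : 'rV[R]_m => v 0 j) @` FU U f x.
  by rewrite /FU image_comp.
apply: (compact_has_sup _ _).2.
  by exists (f (x, u) 0 j), (f (x, u)) => //; exists u.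
apply: continuous_compact => //; apply: continuous_subspaceT.
exact: coord_continuous.
Qed.

Lemma SP_mapP (R : realType) (n k m : nat) (U : set 'rV[R]_k)
    (f : 'rV[R]_n * 'rV[R]_k -> 'rV[R]_m) (l : 'rV[R]_m) (C : set 'rV[R]_m)
    (x : 'rV[R]_n) (c : 'rV[R]_m) :
  SP_map U f l C x (l + c) <->
  [/\ ~ set_sub (FU U f x) (interior (orthant R m)) (l + c), C c &
      forall j, (l + c) 0 j <= ub U f x 0 j].
Proof.
rewrite /SP_map closure_setC interior_sub_orthant; split.
  move=> [yK [[_ -> [c' Cc' /addrI cE]] /sub_orthantP[_ -> yub]]].
  by split=> //; rewrite -cE.
move=> [yK Cc yub]; split => //; split.
  by exists l => //; exists c.
by apply/sub_orthantP; exists (ub U f x).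
Qed.

(** The point where the segment from [l] to [l + c] leaves [F_U(x) - R^m_+]
satisfies the three conditions that define the value of [SP_map] at [x]: this
is how all the points of that value needed below are produced. *)
Lemma SP_map_on_ray (R : realType) (n k m : nat) (U : set 'rV[R]_k)
    (f : 'rV[R]_n * 'rV[R]_k -> 'rV[R]_m) (l : 'rV[R]_m) (C : set 'rV[R]_m)
    (x : 'rV[R]_n) (c : 'rV[R]_m) :
  compact (FU U f x) -> is_cone C ->
  set_sub (FU U f x) (orthant R m) l -> C c ->
  ~ set_sub (FU U f x) (interior (orthant R m)) (l + c) ->
  exists2 t : R, 0 <= t <= 1 & SP_map U f l C x (l + t *: c) /\
    set_sub (FU U f x) (orthant R m) (l + t *: c).
Proof.
move=> cK coneC lK Cc; rewrite -interior_sub_orthant => cNK.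
have [t t01 [tK tNK]] :=
  segment_leaves_closed (closed_sub_orthant cK) lK cNK.
exists t => //; split => //; apply/SP_mapP; split.
- by rewrite -interior_sub_orthant.
- by apply: coneC => //; case/andP: t01.
- exact: sub_orthant_le_ub.
Qed.

(** Both sides compare the sets [F_U - R^m_+] of the two points: the left one
through pieces of their boundaries, which the segments from [l] in directions
of [C] reach, and the right one directly. *)
Lemma l_strict_SP_map (R : realType) (n k m : nat) (U : set 'rV[R]_k)
    (f : 'rV[R]_n * 'rV[R]_k -> 'rV[R]_m) (l : 'rV[R]_m) (C : set 'rV[R]_m)
    (x xbar : 'rV[R]_n) :
  U !=set0 -> compact (FU U f x) -> compact (FU U f xbar) ->
  C `<=` interior (orthant R m) `|` [set 0] -> is_cone C ->
  FU U f x `<=` set_add [set l] (interior C) ->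
  FU U f xbar `<=` set_add [set l] (interior C) ->
  l_strict (SP_map U f l C x) (SP_map U f l C xbar) <->
  FU U f x `<=` set_sub (FU U f xbar) (interior (orthant R m)).
Proof.
move=> [u0 Uu0] cA cB C_sub coneC lA lB.
(* Passing to interiors in [C `<=` orthant R m]. *)
have intC c : interior C c -> forall j, 0 < c 0 j.
  move=> Cc; apply/interior_orthantP; apply: interiorS Cc => d.
  by move=> /C_sub[/interior_subset//|->] j; rewrite mxE.
have l_below y : FU U f y `<=` set_add [set l] (interior C) ->
    set_sub (FU U f y) (interior (orthant R m)) l.
  move=> lK; have [] := lK (f (y, u0)); first by exists u0.
  move=> _ -> [c /intC c0 fE]; apply/sub_interior_orthantP.
  by exists (f (y, u0)); [exists u0|rewrite -fE => j; rewrite mxE ltrDl].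
have weaken K : set_sub K (interior (orthant R m)) `<=` set_sub K (orthant R m).
  by rewrite -interior_sub_orthant; exact: interior_subset.
split.
- move=> BA a Aa; have [_ -> [c /interior_subset Cc aE]] := lA _ Aa.
  apply: contrapT; rewrite -aE => aB.
  (* [a] itself may fail to be below [ub U f xbar], so it is replaced by the
     point where the segment from [l] to [a] leaves [FU U f xbar - orthant]. *)
  have [t /andP[t0 t1] [tF _]] :=
    SP_map_on_ray cB coneC (weaken _ _ (l_below _ lB)) Cc aB.
  have [z [zA _] [r /interior_orthantP r0 zE]] := BA _ tF.
  move: zA; rewrite closure_setC interior_sub_orthant; apply.
  apply/sub_interior_orthantP; exists a => // j.
  have c0 : 0 <= c 0 j.
    by case: (C_sub _ Cc) => [/interior_orthantP/(_ j)/ltW//|->]; rewrite mxE.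
  have /rowP/(_ j) := zE; rewrite -aE !mxE => zEj.
  rewrite (@lt_le_trans _ _ (z 0 j + r 0 j)) ?ltrDl// zEj lerD2l.
  exact: ler_piMl.
- move=> AB y yF; have [_ [[_ -> [c Cc yE]] _]] := yF.
  move: yF; rewrite -yE => /SP_mapP[yB _ _].
  (* [c = 0] is excluded: [l] is strictly dominated by an element of
     [FU U f xbar], whereas [l + c] is not. *)
  have c0 j : 0 < c 0 j.
    case: (C_sub _ Cc) => [/interior_orthantP//|c0].
    by case: yB; rewrite c0 addr0; exact: l_below.
  have yA : ~ set_sub (FU U f x) (orthant R m) (l + c).
    move=> /sub_orthantP[a /AB/sub_interior_orthantP[b Bb ab] ya].
    apply: yB; apply/sub_interior_orthantP; exists b => // j.
    exact: le_lt_trans (ab j).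
  have [t /andP[t0 t1] [tF tA]] :=
    SP_map_on_ray cA coneC (weaken _ _ (l_below _ lA)) Cc
      (yA \o weaken _ _).
  (* [t < 1] because [l + c], unlike [l + t *: c], is outside
     [FU U f x - orthant R m]. *)
  exists (l + t *: c) => //; exists ((1 - t) *: c).
    apply/interior_orthantP => j; rewrite mxE mulr_gt0// subr_gt0 lt_neqAle t1.
    by rewrite andbT; apply/eqP => tE; apply: yA; move: tA; rewrite tE scale1r.
  by rewrite -addrA -scalerDl [t + _]addrC subrK scale1r.
Qed.

Theorem proposition4p5 (R : realType) (n k m : nat)
    (Omega : set 'rV[R]_n) (U : set 'rV[R]_k)
    (f : 'rV[R]_n * 'rV[R]_k -> 'rV[R]_m)
    (l : 'rV[R]_m) (C : set 'rV[R]_m)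
    (Omega_neq0 : Omega !=set0) (Omega_closed : closed Omega)
    (U_neq0 : U !=set0) (U_closed : closed U) (U_compact : compact U)
    (f_cont : {within Omega `*` U, continuous f})
    (C_sub : C `<=` interior (orthant R m) `|` [set 0])
    (C_closed : closed C) (C_cone : is_cone C)
    (C_convex : convex_set C) (C_pointed : pointed_cone C) (C_solid : solid C)
    (f_bound : f @` (Omega `*` U) `<=` set_add [set l] (interior C)) :
  robust_wargmin Omega U f = l_wargmin Omega (SP_map U f l C).
Proof.
have cFU x : Omega x -> compact (FU U f x) by exact: compact_FU.
have lFU x : Omega x -> FU U f x `<=` set_add [set l] (interior C).
  by move=> Ox _ [u Uu <-]; apply: f_bound; exists (x, u).
apply/seteqP; split=> xbar [Oxbar nox]; split=> // -[x Ox xxbar];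
  apply: nox; exists x => //.
  by apply: (l_strict_SP_map _ _ _ C_sub _ _ _).1 xxbar; auto.
by apply: (l_strict_SP_map _ _ _ _ _ _ _).2 xxbar; auto.
Qed.
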